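(* Let $\chi$ be an uncountable limit cardinal, and $\lambda$ a cardinal greater than or equal to $\chi$. Suppose that $\chi$ is a $\lambda$-revision cardinal. Then the following hold: (i) Assuming that $\alpha(\chi)\leq\lambda$, there is a cardinal $\sigma<\chi$ such that $\clubsuit^{cof/\mu^+,\ast}_{\lambda^+}[NS_{\lambda^+}|E^{\lambda^+}_\mu]$ holds for any regular cardinal $\mu$ with $\sigma\leq\mu<\chi$. (ii) Assuming that $2^{<\chi}\leq\lambda$, there is a cardinal $\sigma<\chi$ such that $\clubsuit^\ast_{\lambda^+}[NS_{\lambda^+}|E^{\lambda^+}_\mu]$ holds for any regular cardinal $\mu$ with $\sigma\leq\mu<\chi$. (iii) Assuming that $2^{<\chi}\leq\lambda$ and $2^\lambda=\lambda^+$, there is a cardinal $\sigma<\chi$ such that $\diamondsuit^\ast_{\lambda^+}[NS_{\lambda^+}|E^{\lambda^+}_\mu]$ holds for any regular cardinal $\mu$ with $\sigma\leq\mu<\chi$.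
   Context: Regular cardinals are infinite. For a set $S$ and a cardinal $\tau$, $P_\tau(S)=\{x\subseteq S : |x|<\tau\}$ and $[S]^\tau=\{x\subseteq S:|x|=\tau\}$. For cardinals $\rho_1,\rho_2,\rho_3,\rho_4$ with $\rho_1^+\geq\rho_2$, $\rho_2^+\geq\rho_3\geq\omega$ and $\rho_3\geq\rho_4\geq 2$, the covering number $\mathrm{cov}(\rho_1,\rho_2,\rho_3,\rho_4)$ is the least cardinality of any $X\subseteq P_{\rho_2}(\rho_1)$ such that for any $b\in P_{\rho_3}(\rho_1)$ there is $Q\in P_{\rho_4}(X)$ with $b\subseteq\bigcup Q$. For infinite cardinals $\chi\leq\lambda$, $\chi$ is a $\lambda$-revision cardinal if $\mathrm{cov}(\lambda,\chi,\chi,\sigma)\leq\lambda$ for some cardinal $\sigma<\chi$ (with $\sigma\geq 2$). For an uncountable limit cardinal $\chi$ and an infinite cardinal $\sigma<\chi$, $\alpha(\chi,\sigma)=\sup\{\mathrm{cov}(\tau,\nu,\nu,\sigma):\sigma\leq\nu\leq\tau<\chi\}$ ($\tau,\nu$ cardinals), and $\alpha(\chi)=\min\{\alpha(\chi,\sigma):\omega\leq\sigma<\chi\}$. Let $\tau$ be a regular uncountable cardinal. $NS_\tau$ is the nonstationary ideal on $\tau$. For a regular cardinal $\mu$, $E^\tau_\mu=\{\alpha<\tau:\mathrm{cf}(\alpha)=\mu\}$. For an ideal $J$ on $\tau$, $J^\ast$ is the dual filter, and for $S\subseteq\tau$, $J|S=\{X\subseteq\tau: X\cap S\in J\}$. Let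 $J$ be a $\tau$-complete ideal on $\tau$. For a cardinal $\eta<\tau$, $\clubsuit^{cof/\eta,\ast}_\tau[J]$ asserts the existence of $B^i_\delta\in P_\eta(\delta)$ for $i<\delta<\tau$ such that for any $A\in[\tau]^\tau$, $\{\delta<\tau:\exists i<\delta\,(\sup(A\cap B^i_\delta)=\delta)\}\in J^\ast$. $\clubsuit^\ast_\tau[J]$ asserts the existence of $s^i_\alpha\subseteq\alpha$ with $\sup s^i_\alpha=\alpha$, for each infinite limit ordinal $\alpha<\tau$ and each $i<\alpha$, such that $\{\alpha<\tau:\exists i<\alpha\,(s^i_\alpha\subseteq A)\}\in J^\ast$ for all $A\in[\tau]^\tau$ (where only infinite limit $\alpha$ are considered in this set). $\diamondsuit^\ast_\tau[J]$ asserts the existence of $t^i_\alpha\subseteq\alpha$ for $i<\alpha<\tau$ such that $\{\alpha<\tau:\exists i<\alpha\,(t^i_\alpha=A\cap\alpha)\}\in J^\ast$ for every $A\subseteq\tau$. *)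

(* Defs.v *)
From HB Require Import structures.
From mathcomp Require Import all_boot all_order generic_quotient.
From mathcomp Require Import boolp classical_sets functions cardinality.
From mathcomp Require wochoice.

Set Implicit Arguments.
Unset Strict Implicit.
Unset Printing Implicit Defensive.

Import Order.TTheory.
Local Open Scope classical_set_scope.
Local Open Scope card_scope.
Local Open Scope quotient_scope.

(* Ord, below, is the type of all ordinals: the quotient by isomorphism of the
   well-orders carried by the types of some universe. It lies itself in a larger
   universe, so that it plays the role of the class of all ordinals. *)

Record wo := Wo {
  wsort :> Type;
  wle : rel wsort;
  wleP : wochoice.well_order wle }.

HB.instance Definition _ := gen_eqMixin wo.
HB.instance Definition _ := gen_choiceMixin wo.

Definition wo_iso (W V : wo) : Prop :=
  exists2 f : W -> V, bijective f & forall x y, wle (f x) (f y) = wle x y.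

(* W is isomorphic to an initial segment (possibly all) of V *)
Definition wo_init (W V : wo) : Prop :=
  exists2 f : W -> V, (forall x y, wle (f x) (f y) = wle x y)
                    & forall x y, wle y (f x) -> exists z, f z = y.

Section WellOrder.
Variable W : wo.
Implicit Types x y z : W.

Lemma wmin (A : set W) : A !=set0 -> exists2 x, A x & forall y, A y -> wle x y.
Proof.
move=> [a Aa]; have [|x [[Ax mx] _]] := @wleP W [pred x | `[< A x >]].
  by exists a; rewrite inE.
move: Ax; rewrite inE => Ax; exists x => // y Ay; apply: mx.
by rewrite inE.
Qed.

Lemma wle_refl x : wle x x.
Proof. by have [|y Ay] := @wmin [set x]; [exists x|rewrite Ay; apply]. Qed.

Lemma wle_total x y : wle x y || wle y x.
Proof.
have [|z Az mz] := @wmin [set x; y]; first by exists x; left.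
have zx : wle z x by apply: mz; left.
have zy : wle z y by apply: mz; right.
by case: Az => zE; rewrite zE in zx zy; rewrite ?zx ?zy ?orbT.
Qed.

Lemma wle_anti x y : wle x y -> wle y x -> x = y.
Proof.
move=> xy yx.
have [|z [_ Uz]] := @wleP W [pred z | `[< z = x \/ z = y >]].
  by exists x; rewrite inE; left.
have H t : t = x \/ t = y -> z = t.
  move=> tP; apply: Uz; split; first by rewrite inE.
  by move=> u; rewrite inE; case: tP => -> [] ->; rewrite ?wle_refl.
by rewrite -(H x (or_introl erefl)); apply: H; right.
Qed.

Lemma wle_trans y x z : wle x y -> wle y z -> wle x z.
Proof.
move=> xy yz; have [|t At mt] := @wmin [set u | [\/ u = x, u = y | u = z]].
  by exists x; apply: Or31.
case: At => tE; rewrite {t}tE in mt.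
- by apply: mt; apply: Or33.
- have yx : wle y x by apply: mt; apply: Or31.
  by rewrite (wle_anti xy yx).
- have zy : wle z y by apply: mt; apply: Or32.
  by rewrite -(wle_anti yz zy).
Qed.

Definition wlt x y := ~~ wle y x.

Lemma wltW x y : wlt x y -> wle x y.
Proof. by move/negbTE=> H; have := wle_total x y; rewrite H orbF. Qed.

Lemma wlt_irr x : wlt x x = false.
Proof. by rewrite /wlt wle_refl. Qed.

Lemma wlt_le_trans y x z : wlt x y -> wle y z -> wlt x z.
Proof. by move=> xy yz; apply: contra xy => zx; apply: wle_trans zx. Qed.

Lemma wle_lt_trans y x z : wle x y -> wlt y z -> wlt x z.
Proof. by move=> xy; apply: contra => zx; apply: wle_trans xy. Qed.

Lemma wlt_trans y x z : wlt x y -> wlt y z -> wlt x z.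
Proof. by move=> xy /wltW; apply: wlt_le_trans. Qed.

Lemma wltgt x y : [\/ wlt x y, x = y | wlt y x].
Proof.
have [xy|xy] := boolP (wle x y); last by apply: Or33.
have [yx|yx] := boolP (wle y x); last by apply: Or31.
by apply: Or32; apply: wle_anti.
Qed.

Lemma wind (P : W -> Prop) :
  (forall x, (forall y, wlt y x -> P y) -> P x) -> forall x, P x.
Proof.
move=> H; apply: contrapT => /existsNP nP.
have [x nPx mx] := @wmin (fun x => ~ P x) nP.
by apply: nPx; apply: H => y /negP yx; apply: contrapT => /mx.
Qed.

End WellOrder.

(* x and y have the same rank *)
Inductive wsim (W V : wo) (x : W) (y : V) : Prop := Wsim of
  (forall x', wlt x' x -> exists2 y', wlt y' y & wsim x' y') &
  (forall y', wlt y' y -> exists2 x', wlt x' x & wsim x' y').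

Section Wsim.

Lemma wsim_sym (W V : wo) (x : W) (y : V) : wsim x y -> wsim y x.
Proof.
elim/wind: x y => x IH y [xy yx]; split => [y' /yx[x' lt s]|x' /[dup]lt /xy[y' lt' s]].
  by exists x' => //; apply: IH.
by exists y' => //; apply: IH.
Qed.

Lemma wsim_refl (W : wo) (x : W) : wsim x x.
Proof. by elim/wind: x => x IH; split => y yx; exists y => //; apply: IH. Qed.

Lemma wsim_trans (W V U : wo) (y : V) (x : W) (z : U) :
  wsim x y -> wsim y z -> wsim x z.
Proof.
elim/wind: x y z => x IH y z [xy yx] [yz zy].
split=> [x' /[dup] lx /xy[y' ly s]|z' lz].
  by have [z' lz s'] := yz _ ly; exists z' => //; apply: IH s'.
have [y' ly s] := zy _ lz; have [x' lx s'] := yx _ ly.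
by exists x' => //; apply: IH s.
Qed.

Lemma wsim_inj (W : wo) (x y : W) : wsim x y -> x = y.
Proof.
elim/wind: x y => x IH y [xy yx]; have [lt|//|lt] := wltgt x y.
  have [x' lx' s] := yx _ lt.
  by have E := IH _ lx' _ s; rewrite E wlt_irr in lx'.
have [y' ly' s] := xy _ lt.
by have E := IH _ lt _ s; rewrite -E wlt_irr in ly'.
Qed.

Lemma wsim_funct (W V : wo) (x x' : W) (y y' : V) :
  wsim x y -> wsim x' y' -> wle x x' = wle y y'.
Proof.
have aux (A B : wo) (a a' : A) (b b' : B) :
    wsim a b -> wsim a' b' -> wlt a a' -> wlt b b'.
  move=> s [s1 s2] /s1[b1 lb sb].
  by rewrite (wsim_inj (wsim_trans (wsim_sym s) sb)).
move=> s s'; apply: negb_inj; apply/idP/idP; first exact: aux s' s.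
by apply: (aux) (wsim_sym s') (wsim_sym s).
Qed.

Lemma wsim_init (W V : wo) : (forall x : W, exists y : V, wsim x y) <-> wo_init W V.
Proof.
split=> [/choice[f fP]|[f mf fi] x].
  exists f => [x y|x y yx]; first by rewrite (wsim_funct (fP x) (fP y)).
  have [->|yNx] := pselect (y = f x); first by exists x.
  have lyx : wlt y (f x) by apply/negP => /(wle_anti yx).
  have [_ /(_ y lyx) [z _ s]] := fP x; exists z.
  by apply: wsim_inj; apply: wsim_trans (wsim_sym (fP z)) s.
exists (f x); elim/wind: x => x IH; split=> [x' lx|y' ly].
  by exists (f x'); [rewrite /wlt mf|apply: IH].
have [z zE] := fi _ _ (wltW ly); subst y'; exists z; first by rewrite /wlt -mf.
by apply: IH; rewrite /wlt -mf.
Qed.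

Lemma wsim_total (W V : wo) :
  (forall x : W, exists y : V, wsim x y) \/ (forall y : V, exists x : W, wsim y x).
Proof.
have [|/existsNP nW] := pselect (forall x : W, exists y : V, wsim x y); first by left.
right; apply: contrapT => /existsNP nV.
have [x nx mx] := @wmin W (fun x => ~ exists y : V, wsim x y) nW.
have [y ny my] := @wmin V (fun y => ~ exists x : W, wsim y x) nV.
apply: (nx); exists y; split => [x' lx|y' ly].
  have [y' s] : exists y' : V, wsim x' y'.
    by apply: contrapT => /mx xx'; move: lx; rewrite /wlt xx'.
  exists y' => //; apply/negP => yy'; apply: ny.
  have [E|ne] := pselect (y = y'); first by exists x'; rewrite E; exact: wsim_sym.
  have lt : wlt y y' by apply/negP => /(wle_anti yy').
  by case: s => _ /(_ _ lt)[z _ /wsim_sym s]; exists z.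
have [x' s] : exists x' : W, wsim y' x'.
  by apply: contrapT => /my yy'; move: ly; rewrite /wlt yy'.
exists x'; last exact: wsim_sym.
apply/negP => xx'; apply: nx.
have [E|ne] := pselect (x = x'); first by exists y'; rewrite E; exact: wsim_sym.
have lt : wlt x x' by apply/negP => /(wle_anti xx').
by case: s => _ /(_ _ lt)[z _ /wsim_sym s]; exists z.
Qed.

End Wsim.

Section WoOrder.

Lemma wo_init_refl (W : wo) : wo_init W W.
Proof. by apply/wsim_init => x; exists x; apply: wsim_refl. Qed.

Lemma wo_init_trans (V W U : wo) : wo_init W V -> wo_init V U -> wo_init W U.
Proof.
move=> /wsim_init WV /wsim_init VU; apply/wsim_init => x.
have [y s] := WV x; have [z s'] := VU y; exists z; exact: wsim_trans s s'.
Qed.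

Lemma wo_init_total (W V : wo) : wo_init W V \/ wo_init V W.
Proof. by have [?|?] := wsim_total W V; [left|right]; apply/wsim_init. Qed.

Lemma wo_init_anti (W V : wo) : wo_init W V -> wo_init V W -> wo_iso W V.
Proof.
move=> /wsim_init/choice[f fP] /wsim_init/choice[g gP]; exists f.
  exists g => [x|y]; apply: wsim_inj.
    by apply: wsim_sym; apply: wsim_trans (fP x) (gP _).
  by apply: wsim_sym; apply: wsim_trans (gP y) (fP _).
by move=> x y; rewrite (wsim_funct (fP x) (fP y)).
Qed.

Lemma wo_iso_init (W V : wo) : wo_iso W V -> wo_init W V.
Proof. by move=> [f [g fK gK] mf]; exists f => // x y _; exists (g y). Qed.

Lemma wo_iso_refl (W : wo) : wo_iso W W.
Proof. by exists id => //; exists id. Qed.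

Lemma wo_iso_sym (W V : wo) : wo_iso W V -> wo_iso V W.
Proof.
by move=> [f [g fK gK] mf]; exists g => [|x y]; [exists f|rewrite -mf !gK].
Qed.

Lemma wo_iso_trans (V W U : wo) : wo_iso W V -> wo_iso V U -> wo_iso W U.
Proof.
move=> [f bf mf] [g bg mg]; exists (g \o f) => [|x y]; first exact: bij_comp.
by rewrite /= mg mf.
Qed.

Definition wo_isob (W V : wo) : bool := `[< wo_iso W V >].

Lemma wo_isob_refl : reflexive wo_isob.
Proof. by move=> W; apply/asboolP; apply: wo_iso_refl. Qed.

Lemma wo_isob_sym : symmetric wo_isob.
Proof. by move=> W V; apply: asbool_equiv_eq; split; apply: wo_iso_sym. Qed.

Lemma wo_isob_trans : transitive wo_isob.
Proof.
by move=> V W U /asboolP WV /asboolP VU; apply/asboolP; apply: wo_iso_trans VU.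
Qed.

End WoOrder.

Canonical wo_iso_equiv := EquivRel wo_isob wo_isob_refl wo_isob_sym wo_isob_trans.

Definition Ord : Type := {eq_quot wo_iso_equiv}.
HB.instance Definition _ := Choice.on Ord.
HB.instance Definition _ := EqQuotient.on Ord.

Definition otype (W : wo) : Ord := \pi_Ord W.

Lemma otypeP (W V : wo) : otype W = otype V <-> wo_iso W V.
Proof. by split=> [/eqmodP/asboolP|WV] //; apply/eqmodP/asboolP. Qed.

Lemma otypeK (a : Ord) : otype (repr a) = a.
Proof. exact: reprK. Qed.

Definition ord_le (a b : Ord) : bool := `[< wo_init (repr a) (repr b) >].

Lemma ord_le_refl : reflexive ord_le.
Proof. by move=> a; apply/asboolP; apply: wo_init_refl. Qed.

Lemma ord_le_anti : antisymmetric ord_le.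
Proof.
move=> a b /andP[/asboolP ab /asboolP ba].
by rewrite -(otypeK a) -(otypeK b); apply/otypeP; apply: wo_init_anti.
Qed.

Lemma ord_le_trans : transitive ord_le.
Proof.
by move=> b a c /asboolP ab /asboolP bc; apply/asboolP; apply: wo_init_trans bc.
Qed.

Lemma ord_le_total : total ord_le.
Proof.
by move=> a b; have [?|?] := wo_init_total (repr a) (repr b);
  apply/orP; [left|right]; apply/asboolP.
Qed.

Fact ord_display : Order.disp_t. Proof. exact: Order.Disp tt tt. Qed.

HB.instance Definition _ := Order.Le_isPOrder.Build ord_display Ord
  ord_le_refl ord_le_anti ord_le_trans.
HB.instance Definition _ :=
  Order.POrder_isTotal.Build ord_display Ord ord_le_total.

Section Segment.
Variable W : wo.

Section Seg.
Variable x : W.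

Definition seg_sort : Type := {y : W | wlt y x}.

Lemma seg_wleP : wochoice.well_order (fun y z : seg_sort => wle (sval y) (sval z)).
Proof.
move=> A [a Aa].
have [|_ [y Ay <-] my] := @wmin W [set sval y | y in [set y | y \in A]].
  by exists (sval a); exists a.
exists y; split; first by split => // z Az; apply: my; exists z.
move=> z [Az mz]; apply: val_inj; apply: wle_anti; last exact: mz.
by apply: my; exists z.
Qed.

(* the initial segment of W below x *)
Definition seg : wo := Wo seg_wleP.

Definition in_seg (y : W) (yx : wlt y x) : seg := exist (fun z => wlt z x) y yx.

Lemma seg_wsim (y : seg) : wsim y (sval y).
Proof.
elim/wind: y => y IH; split => [z zy|z zy]; first by exists (sval z) => //; apply: IH.
have zx : wlt z x by apply: wlt_trans zy (proj2_sig y).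
by exists (in_seg zx) => //; apply: (IH (in_seg zx)).
Qed.

End Seg.

Lemma otype_le (V U : wo) : (otype V <= otype U)%O <-> wo_init V U.
Proof.
have E (Z : wo) : wo_iso (repr (otype Z)) Z by apply/otypeP; apply: otypeK.
split=> [/asboolP VU|VU].
  apply: wo_init_trans (wo_iso_init (wo_iso_sym (E V))) _.
  exact: wo_init_trans VU (wo_iso_init (E U)).
apply/asboolP; apply: wo_init_trans (wo_iso_init (E V)) _.
exact: wo_init_trans VU (wo_iso_init (wo_iso_sym (E U))).
Qed.

Lemma otype_seg_le (x y : W) : (otype (seg x) <= otype (seg y))%O = wle x y.
Proof.
apply/idP/idP => [/otype_le/wsim_init s|xy]; last first.
  apply/otype_le/wsim_init => z.
  have zy : wlt (sval z) y by apply: wlt_le_trans (proj2_sig z) xy.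
  exists (in_seg zy); apply: wsim_trans (seg_wsim z) _.
  exact: wsim_sym (seg_wsim (in_seg zy)).
apply: contrapT => /negP yx.
have [z zs] := s (in_seg yx).
have := wsim_trans (wsim_sym (seg_wsim (in_seg yx))) (wsim_trans zs (seg_wsim z)).
by move=> /wsim_inj /= E; have := proj2_sig z; rewrite /= -E wlt_irr.
Qed.

Lemma otype_seg_lt (x : W) : (otype (seg x) < otype W)%O.
Proof.
rewrite ltNge; apply/negP => /otype_le/wsim_init/(_ x)[z s].
have /wsim_inj E := wsim_trans s (seg_wsim z).
by have := proj2_sig z; rewrite /= -E wlt_irr.
Qed.

Lemma lt_otype (a : Ord) : (a < otype W)%O -> exists x : W, a = otype (seg x).
Proof.
rewrite ltNge -(otypeK a); set V := repr a => aW.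
have nW : exists x : W, ~ exists y : V, wsim x y.
  by apply/existsNP => H; move/negP: aW; apply; apply/otype_le/wsim_init.
have [x nx mx] := @wmin W (fun x => ~ exists y : V, wsim x y) nW.
have ex y : wlt y x -> exists z : V, wsim y z.
  by move=> yx; apply: contrapT => /mx xy; rewrite /wlt xy in yx.
exists x; apply/eqP; rewrite eq_le; apply/andP; split; apply/otype_le/wsim_init.
  move=> z; have [VW|WV] := wsim_total V W; last by case: nx; apply: WV.
  have [y s] := VW z.
  have yx : wlt y x.
    apply/negP => xy; apply: nx.
    have [->|ne] := pselect (x = y); first by exists z; apply: wsim_sym.
    have lt : wlt x y by apply/negP => /(wle_anti xy).
    by case: s => _ /(_ _ lt)[u _ /wsim_sym s]; exists u.
  by exists (in_seg yx); apply: wsim_trans s (wsim_sym (seg_wsim (in_seg yx))).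
move=> y; have [z s] := ex _ (proj2_sig y); exists z.
exact: wsim_trans (seg_wsim y) s.
Qed.

End Segment.

Theorem ord_min (A : set Ord) :
  A !=set0 -> exists2 a, A a & forall b, A b -> (a <= b)%O.
Proof.
move=> [a Aa].
have [ma|/existsNP[b /not_implyP[Ab /negP]]] := pselect (forall b, A b -> (a <= b)%O).
  by exists a.
rewrite -ltNge -[a]otypeK; set W := repr a => ba.
have [x0 E] := lt_otype ba.
have [|x Ax mx] := @wmin W (fun x => A (otype (seg x))); first by exists x0; rewrite -E.
exists (otype (seg x)) => // c Ac; have [ac|ca] := leP (otype W) c.
  by apply: le_trans ac; apply/ltW/otype_seg_lt.
by have [y cE] := lt_otype ca; rewrite cE otype_seg_le; apply: mx; rewrite -cE.
Qed.

(* von Neumann: an ordinal is identified with the set of smaller ordinals *)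
Definition below (a : Ord) : set Ord := [set b | (b < a)%O].

Lemma below_otype (W : wo) : below (otype W) #= [set: W].
Proof.
have -> : below (otype W) = (fun x : W => otype (seg x)) @` [set: W].
  apply/seteqP; split=> [a /lt_otype[x ->]|_ [x _ <-]]; first by exists x.
  exact: otype_seg_lt.
apply: inj_card_eq => x y _ _ E; apply: wle_anti; by rewrite -otype_seg_le E.
Qed.

Lemma wo_exists (T : Type) : exists W : wo, [set: W] #= [set: T].
Proof.
by have [R wR] := wochoice.well_ordering_principle {classic T}; exists (@Wo T R wR).
Qed.

Lemma ord_bounded (I : Type) (f : I -> Ord) : exists b, forall i, (f i <= b)%O.
Proof.
pose S : Type := {i : I & wsort (repr (f i))}.
have [R wR] := wochoice.well_ordering_principle {classic S -> bool}.
exists (otype (@Wo (S -> bool) R wR)) => i; rewrite leNgt; apply/negP => /ltW.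
rewrite -[f i]otypeK => /otype_le[g mg _].
have ginj X Y : g X = g Y -> X = Y.
  by move=> E; apply: wle_anti; rewrite -mg E wle_refl.
pose h (X : S -> bool) : S := existT _ i (g X).
pose D s := `[< exists2 X, h X = s & ~~ X s >].
have DhD : ~~ D (h D).
  apply/negP => /[dup] DD /asboolP[X hX /negP]; apply.
  suff -> : X = D by [].
  by apply: ginj; apply: (@eq_from_Tagged {classic I} (fun i => wsort (repr (f i)))) hX.
by move/negP: (DhD); apply; apply/asboolP; exists D.
Qed.

Lemma void_wleP : wochoice.well_order (fun _ _ : void => true).
Proof. by move=> A [[]]. Qed.

Definition ozero : Ord := otype (Wo void_wleP).

(* least element of A; the default value ozero is only used for A empty *)
Definition omin (A : set Ord) : Ord := xget ozero (A `&` lbound A).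

(* least upper bound of A, which is ozero for A empty; the default value ozero
   of supremum is otherwise only used when A is unbounded in Ord *)
Definition osup (A : set Ord) : Ord := supremum ozero A.

(* the least ordinal equipotent to x; the default value of omin is only used
   when x is not small in the sense below *)
Definition card (T : Type) (x : set T) : Ord := omin [set a | x #= below a].

Lemma ominP (A : set Ord) :
  A !=set0 -> A (omin A) /\ forall b, A b -> (omin A <= b)%O.
Proof.
by move=> /ord_min[a Aa ma]; apply: (@xgetI _ _ (A `&` lbound A) a); split.
Qed.

Lemma osupP (A : set Ord) : has_ubound A ->
  (forall a, A a -> (a <= osup A)%O) /\
  (forall b, (forall a, A a -> (a <= b)%O) -> (osup A <= b)%O).
Proof.
move=> /ord_min[s As ms]; rewrite /osup /supremum.
case: ifPn => [/eqP ->|_]; last exact: (@xgetI _ _ (supremums A) s).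
by split=> // b _; rewrite -(otypeK b); apply/otype_le/wsim_init => -[].
Qed.

(* equipotent to a type in the universe of the well-orders (Ord itself is not);
   every set whose cardinality is taken below is small *)
Definition small (T : Type) (x : set T) : Prop := exists W : wo, x #= [set: W].

Lemma small_below (a : Ord) : small (below a).
Proof. by exists (repr a); have := below_otype (repr a); rewrite otypeK. Qed.

Lemma small_le (T U : Type) (x : set T) (y : set U) :
  x #<= y -> small y -> small x.
Proof.
move=> xy [W yW]; rewrite (card_le_eqr yW) in xy.
have /card_leP[f] := xy.
pose g (u : x) : W := val (f u); pose A := range g.
have xA : A #= x.
  apply: card_eq_trans (card_setT x); apply: inj_card_eq => u v _ _ /val_inj.
  by move=> /inj; apply; rewrite in_setT.
have [V VE] := wo_exists {w : W | A w}; exists V.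
apply: card_eq_trans (card_esym xA) _; apply: card_eq_trans (card_esym VE).
have AE : A = range (fun w : {w : W | A w} => sval w).
  by apply/seteqP; split=> [w Aw|_ [w _ <-]]; [exists (exist _ w Aw)|exact: svalP].
rewrite [X in X #= _]AE; apply: inj_card_eq => u v _ _ /eq_sig_hprop; apply=> *.
exact: Prop_irrelevance.
Qed.

Lemma small_subset (T : Type) (x y : set T) : x `<=` y -> small y -> small x.
Proof. by move=> xy; apply: small_le; apply: subset_card_le. Qed.

Lemma small_powerset (a : Ord) : small [set x | x `<=` below a].
Proof.
have [V VE] := wo_exists (repr a -> bool).
apply: (small_le _ (ex_intro _ V (card_esym VE))).
pose g (x : set Ord) (w : repr a) := `[< x (otype (seg w)) >].
have gi : {in [set x | x `<=` below a] &, injective g}.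
  move=> x y; rewrite !inE => xa ya /(congr1 (fun h w => is_true (h w))) E.
  apply/seteqP; split=> b bx.
    have := xa _ bx; rewrite /below/= -{1}(otypeK a) => /lt_otype[w bE].
    by move/(congr1 (@^~ w)): E; rewrite /g !asboolE -bE => <-.
  have := ya _ bx; rewrite /below/= -{1}(otypeK a) => /lt_otype[w bE].
  by move/(congr1 (@^~ w)): E; rewrite /g !asboolE -bE => ->.
by rewrite -(card_le_eql (inj_card_eq gi)); apply: subset_card_le.
Qed.

Lemma cardP (T : Type) (x : set T) : small x -> x #= below (card x).
Proof.
move=> [W xW]; suff H : [set a | x #= below a] !=set0 by case: (ominP H).
exists (otype W); apply: card_eq_trans xW (card_esym _).
exact: below_otype.
Qed.

Definition is_cardinal (k : Ord) : Prop := card (below k) = k.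

Definition omega : Ord := card [set: nat].

Definition two : Ord := card [set: bool].

Definition csucc (k : Ord) : Ord := omin [set m | is_cardinal m /\ (k < m)%O].

Definition is_limit_cardinal (k : Ord) : Prop :=
  is_cardinal k /\ forall m, is_cardinal m -> (m < k)%O -> (csucc m < k)%O.

(* an infinite limit ordinal *)
Definition is_limit (d : Ord) : Prop :=
  (ozero < d)%O /\ forall a, (a < d)%O -> exists2 b, (a < b)%O & (b < d)%O.

Definition is_cofinal (d : Ord) (A : set Ord) : Prop :=
  A `<=` below d /\ forall a, (a < d)%O -> exists2 b, A b & (a <= b)%O.

Definition cf (d : Ord) : Ord := omin [set card A | A in is_cofinal d].

Definition is_regular (k : Ord) : Prop :=
  [/\ is_cardinal k, (omega <= k)%O & cf k = k].

Definition pow2 (k : Ord) : Ord := card [set x | x `<=` below k].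

Definition pow2_lt (k : Ord) : Ord :=
  osup [set pow2 m | m in [set m | is_cardinal m /\ (m < k)%O]].

(* P_t(S) *)
Definition Psub (T : Type) (t : Ord) (S : set T) : set (set T) :=
  [set x | x `<=` S /\ (card x < t)%O].

(* [S]^t *)
Definition subsets_of_card (T : Type) (S : set T) (t : Ord) : set (set T) :=
  [set x | x `<=` S /\ card x = t].

Definition is_covering (r1 r2 r3 r4 : Ord) (X : set (set Ord)) : Prop :=
  X `<=` Psub r2 (below r1) /\
  forall b, Psub r3 (below r1) b ->
    exists2 Q, Psub r4 X Q & b `<=` \bigcup_(q in Q) q.

(* only meaningful for r1^+ >= r2, r2^+ >= r3 >= omega and r3 >= r4 >= 2 *)
Definition cov (r1 r2 r3 r4 : Ord) : Ord :=
  omin [set card X | X in is_covering r1 r2 r3 r4].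

Definition revision_cardinal (lambda chi : Ord) : Prop :=
  exists s, [/\ is_cardinal s, (two <= s)%O, (s < chi)%O
              & (cov lambda chi chi s <= lambda)%O].

Definition alpha2 (chi s : Ord) : Ord :=
  osup [set k | exists t n, [/\ is_cardinal t, is_cardinal n,
    (s <= n <= t)%O, (t < chi)%O & k = cov t n n s]].

Definition alpha (chi : Ord) : Ord :=
  omin [set alpha2 chi s |
    s in [set s | is_cardinal s /\ (omega <= s < chi)%O]].

(* An ideal on t is given as a set J of subsets of t. *)

Definition dual_filter (t : Ord) (J : set (set Ord)) : set (set Ord) :=
  [set X | X `<=` below t /\ J (below t `\` X)].

Definition restr_ideal (t : Ord) (J : set (set Ord)) (S : set Ord) :
    set (set Ord) :=
  [set X | X `<=` below t /\ J (X `&` S)].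

Definition is_club (t : Ord) (C : set Ord) : Prop :=
  is_cofinal t C /\
  forall d, is_limit d -> (d < t)%O -> is_cofinal d (C `&` below d) -> C d.

Definition is_stationary (t : Ord) (S : set Ord) : Prop :=
  forall C, is_club t C -> S `&` C !=set0.

Definition NS (t : Ord) : set (set Ord) :=
  [set X | X `<=` below t /\ ~ is_stationary t X].

Definition cof_points (t m : Ord) : set Ord := [set a | (a < t)%O /\ cf a = m].

Definition club_cof_star (eta t : Ord) (J : set (set Ord)) : Prop :=
  exists B : Ord -> Ord -> set Ord,
    (forall d i, (i < d)%O -> (d < t)%O -> Psub eta (below d) (B d i)) /\
    forall A, subsets_of_card (below t) t A ->
      dual_filter t J
        [set d | (d < t)%O /\ exists2 i, (i < d)%O & osup (A `&` B d i) = d].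

Definition club_star (t : Ord) (J : set (set Ord)) : Prop :=
  exists s : Ord -> Ord -> set Ord,
    (forall a i, is_limit a -> (a < t)%O -> (i < a)%O ->
       s a i `<=` below a /\ osup (s a i) = a) /\
    forall A, subsets_of_card (below t) t A ->
      dual_filter t J
        [set a | [/\ is_limit a, (a < t)%O
                   & exists2 i, (i < a)%O & s a i `<=` A]].

Definition diamond_star (t : Ord) (J : set (set Ord)) : Prop :=
  exists u : Ord -> Ord -> set Ord,
    (forall a i, (i < a)%O -> (a < t)%O -> u a i `<=` below a) /\
    forall A, A `<=` below t ->
      dual_filter t J
        [set a | (a < t)%O /\ exists2 i, (i < a)%O & u a i = A `&` below a].

(* Main.v *)
From HB Require Import structures.
From mathcomp Require Import all_boot all_order.
From mathcomp Require Import boolp classical_sets functions cardinality.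
From mathcomp Require wochoice.
Require Import Defs.

(** Fix a family of at most lambda sets covering the small subsets of lambda and
    carry it, by a bijection, to each d with lambda <= d < lambda^+. If d has
    cofinality mu, a cofinal subset e of d of size mu and its image h(e) under a
    map h of d into itself are both small; h(e) is covered by fewer than
    s <= mu = cf(d) members of the family, so for one member q the points of e
    sent into q by h are still cofinal in d ([covers_cofinal], a consequence of
    the pigeonhole principle [cofinal_split]). All three assertions come from this
    by choosing h and refining the family, without leaving size lambda.

    - Club guessing by small sets: h is the identity and e lies in the given set
      A. The member q found has size < chi, and the bound on alpha(chi) provides
      lambda sets of size <= mu covering the subsets of q of size <= mu; a second
      use of the pigeonhole principle selects one of these ([thin_family]).
    - Club guessing by subsets of A: since q has at most 2^(<chi) <= lambda
      subsets, all of them enter the family, among them the trace of e on q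
      ([subset_guessing] with h the identity).
    - Diamond: as 2^lambda = lambda^+, the bounded subsets of lambda^+ are listed
      as a(i) for i < lambda^+. Let h(c) be an index of A meet c. At a point d closed
      under h, the family catches z = h(e') for some e' cofinal in d, and
      the union of the a(i) for i in z is A meet d.

    The exceptional points d are avoided by the club of points closed under a
    function on lambda^+ ([closure_points_club]). Everything rests on
    k * k = k for infinite k ([card_square_le]), which makes lambda^+ regular and
    bounds unions of lambda sets of size lambda. *)

Set Implicit Arguments.
Unset Strict Implicit.
Unset Printing Implicit Defensive.

Import Order.TTheory.
Local Open Scope classical_set_scope.
Local Open Scope card_scope.

(** A choice of default value, required by the lemmas of [cardinality] that turn
    a comparison of cardinals into a function with values in Ord. *)
HB.instance Definition _ := isPointed.Build Ord ozero.

(** * Comparing cardinals through functions *)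

Lemma card_le_injfun (T U : Type) (A : set T) (B : set U) (f : T -> U) :
  (forall x, A x -> B (f x)) ->
  (forall x y, A x -> A y -> f x = f y -> x = y) -> A #<= B.
Proof.
move=> AB fi; have /card_esym E : f @` A #= A.
  by apply: inj_card_eq => x y; rewrite !inE; apply: fi.
by rewrite (card_le_eql E); apply: subset_card_le => _ [x Ax <-]; apply: AB.
Qed.

Lemma card_le_surjfun (T U : Type) (A : set T) (B : set U) (t0 : T) :
  A #<= B -> exists g : U -> T, A `<=` g @` B.
Proof.
move=> /pfcard_geP[->|[g]]; first by exists (fun=> t0).
by exists g; apply: surj.
Qed.

Lemma card_le_sub_image (T U : Type) (A : set T) (B : set U) (g : U -> T) :
  A `<=` g @` B -> A #<= B.
Proof. by move=> /subset_card_le /card_le_trans; apply; apply: card_image_le. Qed.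

(** Lists a possibly empty A by a total function all of whose values obey P, so
    that no index has to be treated separately. *)
Lemma card_le_enum (T U : Type) (A : set T) (B : set U) (P : set T) (t0 : T) :
  P t0 -> A `<=` P -> A #<= B ->
  exists g : U -> T, (forall u, P (g u)) /\
    forall t, A t -> exists2 u, B u & g u = t.
Proof.
move=> Pt0 AP /(card_le_surjfun t0)[g gA].
exists (fun u => if `[< P (g u) >] then g u else t0); split=> [u|t At].
  by case: asboolP.
have [u Bu ut] := gA _ At; exists u => //; rewrite ut.
by case: asboolP => // -[]; apply: AP.
Qed.

Lemma card_le_setX (T U T' U' : Type) (A : set T) (B : set U) (A' : set T')
    (B' : set U') : A #<= A' -> B #<= B' -> A `*` B #<= A' `*` B'.
Proof.
move=> AA BB; have [->|/set0P[[a0 b0] _]] := eqVneq (A `*` B) set0.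
  exact: card_ge0.
have [g gA] := card_le_surjfun a0 AA; have [h hB] := card_le_surjfun b0 BB.
apply: (@card_le_sub_image _ _ _ _ (fun p => (g p.1, h p.2))) => -[a b] [/= Aa Bb].
have [a' Aa' <-] := gA _ Aa; have [b' Bb' <-] := hB _ Bb.
by exists (a', b').
Qed.

Lemma card_le_powerset (T U : Type) (A : set T) (B : set U) :
  A #<= B -> [set x | x `<=` A] #<= [set x | x `<=` B].
Proof.
have [->|/set0P[a0 _]] := eqVneq A set0.
  move=> _; apply: (@card_le_injfun _ _ _ _ (fun=> set0)) => [x _ y//|x y].
  by rewrite /= !subset0 => -> ->.
move=> /(card_le_surjfun a0)[g gA].
apply: (@card_le_injfun _ _ _ _ (fun z => B `&` g @^-1` z)) => [z _ x []//|].
have E z : z `<=` A -> z = g @` (B `&` g @^-1` z).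
  move=> zA; apply/seteqP; split=> [t zt|_ [u [_ /= zu] <-]//].
  by have [u Bu ut] := gA _ (zA _ zt); exists u => //; split; rewrite //= ut.
by move=> z z' /= /E {2}-> /E {2}-> ->.
Qed.

(** * Cardinals as ordinals *)

(** The universe constraint is the content: this applies to the types that carry
    a well-order of type wo, and not to Ord. *)
Lemma small_set (T : Type) (A : set T) : small A.
Proof.
have [W WT] := wo_exists T.
by apply: (small_subset (y := setT)) => //; exists W; apply: card_esym.
Qed.

Lemma small_finite (T : Type) (A : set T) : finite_set A -> small A.
Proof. by move=> /finite_set_countable /small_le; apply; apply: small_set. Qed.

Lemma small_image (T U : Type) (f : T -> U) (A : set T) :
  small A -> small (f @` A).
Proof. by apply: small_le; apply: card_image_le. Qed.

Lemma card_congr (T U : Type) (x : set T) (y : set U) : x #= y -> card x = card y.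
Proof.
move=> xy; congr omin; apply/seteqP; split=> a /=.
  by apply: card_eq_trans; apply: card_esym.
exact: card_eq_trans.
Qed.

Lemma card_below_le a : (card (below a) <= a)%O.
Proof.
have [|_] := @ominP [set b | below a #= below b]; first by exists a => /=.
by apply => /=.
Qed.

Lemma below_sub a b : (a <= b)%O -> below a `<=` below b.
Proof. by move=> ab c /lt_le_trans; apply. Qed.

Lemma card_leE (T U : Type) (x : set T) (y : set U) :
  small x -> small y -> (card x <= card y)%O = (x #<= y).
Proof.
move=> /cardP xE /cardP yE; rewrite (card_le_eql xE) (card_le_eqr yE).
apply/idP/idP => [/below_sub/subset_card_le//|]; rewrite leNgt => xy.
apply/negP => yx; have E : below (card x) #= below (card y).
  by rewrite card_eq_le xy subset_card_le //; apply: below_sub; apply: ltW.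
have := card_below_le (card y).
by rewrite -(card_congr E) -(card_congr xE) leNgt yx.
Qed.

Lemma card_is_cardinal (T : Type) (x : set T) : small x -> is_cardinal (card x).
Proof. by move=> /cardP/card_congr. Qed.

Lemma card_le_cardinal (T : Type) (x : set T) k :
  small x -> is_cardinal k -> (card x <= k)%O = (x #<= below k).
Proof. by move=> sx {1}<-; rewrite card_leE //; apply: small_below. Qed.

Lemma omega_cardinal : is_cardinal omega.
Proof. exact/card_is_cardinal/small_set. Qed.

Lemma omega_le_card (T : Type) (x : set T) :
  small x -> (omega <= card x)%O <-> infinite_set x.
Proof. by move=> sx; rewrite infiniteP card_leE //; apply: small_set. Qed.

Lemma card_finite (T : Type) (x : set T) : finite_set x -> (card x < omega)%O.
Proof.
move=> /[dup] fx /small_finite sx; rewrite ltNge; apply/negP.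
by move=> /(omega_le_card sx).
Qed.

Lemma below_infinite a : (omega <= a)%O -> infinite_set (below a).
Proof.
move=> /below_sub/sub_infinite_set; apply.
by apply/(omega_le_card (small_below _)); rewrite omega_cardinal.
Qed.

Lemma card_le_finite_below (T : Type) (x : set T) a :
  finite_set x -> (omega <= a)%O -> x #<= below a.
Proof.
move=> fx /below_infinite/infiniteP; apply: card_le_trans.
exact: finite_set_countable.
Qed.

Lemma ord_ind (P : Ord -> Prop) :
  (forall a, (forall b, (b < a)%O -> P b) -> P a) -> forall a, P a.
Proof.
move=> H; apply: contrapT => /existsNP nP.
have [a nPa ma] := @ord_min (fun a => ~ P a) nP.
apply: nPa; apply: H => b ba; apply: contrapT => /ma.
by rewrite leNgt ba.
Qed.

(** * The square of an infinite cardinal *)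

(** Order T by the value of f, and each fibre of f by any well-order of T. *)
Lemma wo_refine (W : wo) (T : Type) (f : T -> W) :
  exists2 R : rel T, wochoice.well_order R & forall x y, R x y -> wle (f x) (f y).
Proof.
have [R0 wR] := wochoice.well_ordering_principle {classic T}.
pose V := @Wo T R0 wR.
exists (fun x y => wlt (f x) (f y) || (wle (f x) (f y) && @wle V x y)); last first.
  by move=> x y /orP[/wltW//|/andP[]].
move=> A [a Aa].
have [|w [b [Ab bw]] mw] := @wmin W [set w | exists b, b \in A /\ f b = w].
  by exists (f a); exists a.
have [|c [Ac cw] mc] := @wmin V [set c | c \in A /\ f c = w]; first by exists b.
have lc y : y \in A -> wlt (f c) (f y) || wle (f c) (f y) && @wle V c y.
  move=> Ay; have wy : wle w (f y) by apply: mw; exists y.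
  rewrite cw /wlt wy /=; have [yw|//] := boolP (wle (f y) w).
  by apply: mc; split => //; apply: wle_anti.
exists c; split; first by split.
move=> z [Az mz]; have := lc _ Az; have := mz _ Ac; rewrite cw /wlt.
case: (boolP (wle w (f z))) => [wz|/negbTE wz] /=; last first.
  by move=> _; have := mw (f z) (ex_intro _ z (conj Az erefl)); rewrite wz.
case: (boolP (wle (f z) w)) => //= zw zc cz.
exact: (@wle_anti V).
Qed.

(** In a well-order of T refining f, each proper initial segment lies in a set
    of points where f is bounded, hence has fewer than W elements; so the order
    type of T is at most that of W. *)
Lemma card_le_initial (W : wo) (T : Type) (f : T -> W) :
  is_cardinal (otype W) ->
  (forall w, (card [set t | wle (f t) w] < otype W)%O) ->
  (card [set: T] <= otype W)%O.
Proof.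
move=> Wc Wf; have [R wR Rf] := wo_refine f; pose V := @Wo T R wR.
rewrite leNgt; apply/negP.
have <- : card (below (otype V)) = card [set: T].
  by apply: card_congr; apply: below_otype.
move=> /lt_le_trans/(_ (card_below_le _))/lt_otype[t tE].
have := Wf (f t); rewrite ltNge => /negP; apply.
rewrite -[X in (X <= _)%O]Wc tE (card_congr (below_otype _)).
rewrite card_leE; [|exact: small_set|exact: small_set].
apply: (@card_le_injfun _ _ _ _ (fun u : seg t => sval u)) => [u _ /=|u v _ _].
  apply: Rf; exact: (wltW (proj2_sig u)).
exact: val_inj.
Qed.

(** By induction on a, which may be taken to be a cardinal. The map sending a pair to
    its maximum satisfies the hypothesis of [card_le_initial]: the pairs with
    maximum at most w form the square of {z | z <= w}, which is finite or, by
    induction, of the size of the ordinal b of w. *)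
Theorem card_square_le a : (omega <= a)%O -> below a `*` below a #<= below a.
Proof.
elim/ord_ind: a => a IH wa.
have := card_below_le a; rewrite le_eqVlt => /orP[/eqP ca|ca]; last first.
  have aE := cardP (small_below a).
  have wc : (omega <= card (below a))%O.
    by apply/omega_le_card; [apply: small_below|apply: below_infinite].
  rewrite (card_le_eqr aE); apply: card_le_trans (IH _ ca wc).
  by apply: card_le_setX; rewrite (card_le_eql aE) card_lexx.
pose W := repr a; have aW : otype W = a by apply: otypeK.
have bW : below a #= [set: W] by rewrite -aW; apply: below_otype.
apply: (@card_le_trans _ _ _ [set: W * W]).
  by rewrite -setXTT; apply: card_le_setX; rewrite (card_le_eql bW) card_lexx.
rewrite -card_le_cardinal //; last exact: small_set.
pose f (p : W * W) := if wle p.1 p.2 then p.2 else p.1.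
rewrite -[X in (_ <= X)%O]aW; apply: (card_le_initial (f := f)); rewrite aW // => w.
pose D := [set z : W | wle z w].
have /subset_card_le : [set t | wle (f t) w] `<=` D `*` D.
  move=> [x y]; rewrite /f /D /=; case: ifPn => /= [xy yw|/wltW yx xw].
    by split => //=; apply: wle_trans yw.
  by split => //=; apply: wle_trans xw.
rewrite -card_leE; [|exact: small_set|exact: small_set].
move=> /le_lt_trans; apply.
have [fD|iD] := pselect (finite_set D).
  by apply: lt_le_trans wa; apply: card_finite; apply: finite_setX.
pose b := otype (seg w); have ba : (b < a)%O by rewrite -aW; apply: otype_seg_lt.
have ib : infinite_set (below b).
  rewrite (eq_finite_set (below_otype _)) => fs; apply: iD.
  apply: (@sub_finite_set _ _ ([set w] `|` (fun u : seg w => sval u) @` setT)).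
    move=> z zw; have [wz|zw'] := boolP (wle w z); first by left; apply: wle_anti.
    by right; exists (in_seg zw').
  by rewrite finite_setU; split; [apply: finite_set1|apply: finite_image].
have wb : (omega <= b)%O.
  by apply: le_trans (card_below_le b); apply/omega_le_card => //; apply: small_below.
(* D is a copy of b with one more point, and embeds in b * b *)
have Db : D #<= below b.
  apply: card_le_trans (IH _ ba wb).
  have /infiniteP/pcard_leP[g] := ib.
  pose h z := if `[< z = w >] then (g 0%N, g 1%N) else (otype (seg z), g 0%N).
  have gb n : below b (g n) by apply: funS.
  apply: (@card_le_injfun _ _ _ _ h) => [z zw|z z' _ _].
    rewrite /h; case: asboolP => [_|zNw]; split => //=.
    rewrite /below /= /b lt_def otype_seg_le [wle z w]zw andbT.
    apply: contra_notN zNw => /eqP E; apply: wle_anti => //.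
    by rewrite -otype_seg_le E.
  have g01 : g 0%N <> g 1%N.
    by move=> E; have := @inj _ _ _ g 0%N 1%N; rewrite !in_setT => /(_ isT isT E).
  rewrite /h; case: asboolP => zw; case: asboolP => zw' E; first by rewrite zw zw'.
  - by case: E => _ /esym.
  - by case: E => _ /g01.
  by case: E => E; apply: wle_anti; rewrite -otype_seg_le E.
apply: le_lt_trans (ba); apply: le_trans (card_below_le b).
rewrite card_leE; [|exact: small_set|exact: small_below].
by apply: card_le_trans (IH _ ba wb); apply: card_le_setX.
Qed.

Lemma card_le_bigcup (I T : Type) (k : Ord) (X : set I) (Y : I -> set T) :
  (omega <= k)%O -> X #<= below k -> (forall i, X i -> Y i #<= below k) ->
  \bigcup_(i in X) Y i #<= below k.
Proof.
move=> wk Xk Yk; have [->|/set0P[t0 [i0 _ _]]] := eqVneq (\bigcup_(i in X) Y i) set0.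
  exact: card_ge0.
have [f fX] := card_le_surjfun i0 Xk.
have /choice[g gP] i : exists g : Ord -> T, X i -> Y i `<=` g @` below k.
  have [Xi|] := pselect (X i); last by exists (fun=> t0).
  by have [g gY] := card_le_surjfun t0 (Yk _ Xi); exists g.
apply: card_le_trans (card_square_le wk).
apply: (@card_le_sub_image _ _ _ _ (fun p => g (f p.1) p.2)) => t [i Xi Yit].
have [u uk uE] := fX _ Xi; have [v vk vE] := gP _ Xi _ Yit.
by exists (u, v); rewrite //= uE.
Qed.

Lemma card_le_setU (T : Type) (k : Ord) (A B : set T) :
  (omega <= k)%O -> A #<= below k -> B #<= below k -> A `|` B #<= below k.
Proof.
move=> wk Ak Bk.
apply: (@card_le_trans _ _ _ (\bigcup_(b in [set: bool]) if b then A else B)).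
  by apply: subset_card_le => t [At|Bt]; [exists true|exists false].
apply: card_le_bigcup => // [|[] _ //].
by apply: card_le_finite_below.
Qed.

(** * Successor cardinals and their clubs *)

(** Cantor's diagonal argument. *)
Lemma pow2_gt k : (k < pow2 k)%O.
Proof.
rewrite ltNge; apply/negP => /below_sub/subset_card_le.
have /cardP/card_eqPle[pE _] := small_powerset k.
move=> /(card_le_trans pE)/(card_le_surjfun set0)[g gP].
pose D := [set b | below k b /\ ~ g b b].
have [b [bk bE]] : exists b, below k b /\ g b = D.
  by have [|b bk bE] := gP D; [move=> b []|exists b].
have nD : ~ D b by move=> /[dup] -[_ nb]; rewrite -bE.
by apply: (nD); split => //; rewrite bE.
Qed.

Lemma csuccP k : [/\ is_cardinal (csucc k), (k < csucc k)%O
  & forall m, is_cardinal m -> (k < m)%O -> (csucc k <= m)%O].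
Proof.
have [|[? ?] H] := @ominP [set m | is_cardinal m /\ (k < m)%O].
  exists (pow2 k); split; last exact: pow2_gt.
  exact/card_is_cardinal/small_powerset.
by split=> // m mc km; apply: H.
Qed.

Lemma card_lt_csucc (T : Type) (x : set T) k : small x -> is_cardinal k ->
  (card x < csucc k)%O = (x #<= below k).
Proof.
move=> sx kc; have [_ lk mk] := csuccP k; rewrite -card_le_cardinal //.
apply/idP/idP => [|/le_lt_trans]; last exact.
by apply: contraTT; rewrite -ltNge -leNgt; apply/mk/card_is_cardinal.
Qed.

Lemma below_lt_csucc b k : is_cardinal k -> (b < csucc k)%O -> below b #<= below k.
Proof.
move=> kc bk; rewrite -card_lt_csucc //; last exact: small_below.
exact: le_lt_trans (card_below_le b) bk.
Qed.

(** Otherwise every ordinal below the successor of k would be some f i or lie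
    below some f i, and there are only k * k = k such ordinals. *)
Lemma csucc_regular (I : Type) k (X : set I) (f : I -> Ord) :
  is_cardinal k -> (omega <= k)%O -> X #<= below k ->
  (forall i, X i -> (f i < csucc k)%O) ->
  exists2 b, (b < csucc k)%O & forall i, X i -> (f i < b)%O.
Proof.
move=> kc wk Xk fk; pose U := (\bigcup_(i in X) below (f i)) `|` f @` X.
have Uk : U #<= below k.
  apply: card_le_setU => //; last exact: card_le_trans (card_image_le _ _) Xk.
  by apply: card_le_bigcup => // i /fk; apply: below_lt_csucc.
have [b bk bU] : exists2 b, (b < csucc k)%O & ~ U b.
  apply: contrapT => nb; have : below (csucc k) #<= below k.
    apply: card_le_trans Uk; apply: subset_card_le => b bk.
    by apply: contrapT => nU; apply: nb; exists b.
  rewrite -card_lt_csucc //; last exact: small_below.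
  by have [-> _ _] := csuccP k; rewrite ltxx.
exists b => // i Xi; rewrite ltNge le_eqVlt; apply/negP => /orP[/eqP bi|bi].
  by apply: bU; right; exists i.
by apply: bU; left; exists i.
Qed.

(** The requirement k <= d serves to list families of size k by the indices
    i < d. *)
Definition closure_points k (h : Ord -> Ord) : set Ord :=
  [set d | [/\ (d < csucc k)%O, (k <= d)%O & forall a, (a < d)%O -> (h a < d)%O]].

Lemma osup_lt (x : set Ord) a :
  has_ubound x -> (a < osup x)%O -> exists2 b, x b & (a < b)%O.
Proof.
move=> /osupP[_ sx]; rewrite ltNge => /negP ax; apply: contrapT => nx.
by apply: ax; apply: sx => b xb; rewrite leNgt; apply/negP => ab; apply: nx; exists b.
Qed.

(** For unboundedness, iterate omega times the passage from d to a bound of the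
    values of h below d; the supremum is closed under h. *)
Lemma closure_points_club k h : is_cardinal k -> (omega <= k)%O ->
  (forall a, (a < csucc k)%O -> (h a < csucc k)%O) ->
  is_club (csucc k) (closure_points k h).
Proof.
move=> kc wk hk; split; last first.
  move=> d [d0 dl] dk [_ dC]; split => // [|a ad].
    by have [b [[_ kb _] bd] _] := dC _ d0; apply: le_trans kb (ltW bd).
  have [b ab bd] := dl _ ad; have [c [[_ _ hc] cd] bc] := dC _ bd.
  by apply: lt_trans cd; apply: hc; apply: lt_le_trans bc.
split=> [d []//|g gk].
have /choice[F FP] d : exists e, (d < csucc k)%O ->
    [/\ (e < csucc k)%O, (d <= e)%O & forall a, (a < d)%O -> (h a < e)%O].
  have [dk|] := boolP (d < csucc k)%O; last by exists d.
  have [|e ek eh] := @csucc_regular _ k (below d) h kc wk (below_lt_csucc kc dk).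
    by move=> a ad; apply: hk; apply: lt_trans dk.
  exists (Order.max e d) => _; split; first by rewrite gt_max ek.
    by rewrite le_max lexx orbT.
  by move=> a /eh; rewrite lt_max => ->.
pose D n := iter n F (Order.max g k).
have Dk n : (D n < csucc k)%O.
  elim: n => [|n IH] /=; last by case: (FP _ IH).
  by rewrite gt_max gk; have [] := csuccP k.
have [|b bk Db] := @csucc_regular _ k [set: nat] D kc wk _ (fun n _ => Dk n).
  by apply/infiniteP/below_infinite.
have uD : has_ubound (range D) by exists b => _ [n _ <-]; apply: ltW; apply: Db.
have [Dle Dmin] := osupP uD; pose d := osup (range D).
have D0 : (Order.max g k <= d)%O by apply: Dle; exists 0%N.
exists d; last by apply: le_trans D0; rewrite le_max lexx.
split=> [||a ad].
- by apply: le_lt_trans bk; apply: Dmin => _ [n _ <-]; apply: ltW; apply: Db.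
- by apply: le_trans D0; rewrite le_max lexx orbT.
have [_ [n _ <-] an] := osup_lt uD ad.
have [_ _ /(_ _ an) hF] := FP _ (Dk n).
by apply: lt_le_trans hF _; apply: Dle; exists n.+1.
Qed.

Lemma dual_filter_club t C S Y : is_club t C -> Y `<=` below t ->
  (forall d, C d -> S d -> Y d) -> dual_filter t (restr_ideal t (NS t) S) Y.
Proof.
move=> cC Yt CSY; split => //; split; first by move=> d [].
split=> [d [[]]//|/(_ C cC)[d [[[_ nY] Sd] Cd]]].
by apply: nY; apply: CSY.
Qed.

(** * Cofinal sets *)

Lemma ozero_le a : (ozero <= a)%O.
Proof. by rewrite -(otypeK a); apply/otype_le/wsim_init => -[]. Qed.

Lemma cf_witness d : exists2 D, is_cofinal d D & card D = cf d.
Proof.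
have [|[D Dd DE] _] := @ominP [set card A | A in is_cofinal d]; last by exists D.
by exists (card (below d)), (below d) => //; split => // a ad; exists a.
Qed.

Lemma cf_le d A : is_cofinal d A -> (cf d <= card A)%O.
Proof.
move=> dA; have H : [set card A | A in is_cofinal d] !=set0 by exists (card A), A.
by have [_] := ominP H; apply; exists A.
Qed.

Lemma small_cofinal d A : is_cofinal d A -> small A.
Proof. by move=> [/small_subset + _]; apply; apply: small_below. Qed.

(** At zero or at a successor a set with at most one point is cofinal. *)
Lemma cf_is_limit d : (omega <= cf d)%O -> is_limit d.
Proof.
move=> wd; have Ncof A : is_cofinal d A -> ~ finite_set A.
  by move=> /cf_le /(le_trans wd) + /card_finite; rewrite leNgt => /negP.
split.
  rewrite lt_def ozero_le andbT; apply/eqP => d0; apply: (Ncof set0) => //.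
  by split=> // a; rewrite d0 ltNge ozero_le.
move=> a ad; apply: contrapT => na; apply: (Ncof [set a]) => //.
split=> [_ ->//|c cd]; exists a => //; rewrite leNgt; apply/negP => ac.
by apply: na; exists c.
Qed.

Lemma osup_cofinal d A : is_limit d -> is_cofinal d A -> osup A = d.
Proof.
move=> [_ dl] [Ad dA]; have uA : has_ubound A by exists d => a /Ad/ltW.
have [Ale Amin] := osupP uA; apply/eqP; rewrite eq_le Amin /=; last by move=> a /Ad/ltW.
rewrite leNgt; apply/negP => /dl[c sc /dA[b /Ale bs cb]].
by have := lt_le_trans sc (le_trans cb bs); rewrite ltxx.
Qed.

Lemma cofinal_below_limit d A : is_limit d -> is_cofinal d A ->
  forall a, (a < d)%O -> exists2 b, A b & (a < b)%O.
Proof.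
move=> [_ dl] [_ dA] a /dl[c ac /dA[b Ab cb]]; exists b => //.
exact: lt_le_trans cb.
Qed.

(** If each e meet P q were bounded by some a q < d, then the values a q would be
    cofinal in d, against card Q < cf d. *)
Lemma cofinal_split (I : Type) d (e : set Ord) (Q : set I) (P : I -> set Ord) :
  small Q -> is_cofinal d e -> e `<=` \bigcup_(q in Q) P q ->
  (card Q < cf d)%O -> exists2 q, Q q & is_cofinal d (e `&` P q).
Proof.
move=> sQ [ed de] eQ; rewrite ltNge => /negP Qd; apply: contrapT => nQ; apply: Qd.
have /choice[a aP] q : exists a, Q q ->
    (a < d)%O /\ forall b, e b -> P q b -> (b < a)%O.
  have [Qq|] := pselect (Q q); last by exists ozero.
  apply: contrapT => na; apply: nQ; exists q => //; split=> [b [/ed]//|a ad].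
  apply: contrapT => nb; apply: na; exists a => _; split => // b eb Pb.
  by rewrite ltNge; apply/negP => ab; apply: nb; exists b.
apply: le_trans (cf_le (A := a @` Q) _) _; last first.
  by rewrite card_leE ?card_image_le //; apply: small_image.
split=> [_ [q Qq <-]|c /de[b eb cb]]; first by case: (aP _ Qq).
have [q Qq Pb] := eQ _ eb; exists (a q); first by exists q.
by have [_ /(_ _ eb Pb)/ltW] := aP _ Qq; apply: le_trans.
Qed.

(** If h sends each a to an element of A that is at least a, then the points closed
    under h are limit points of A. *)
Lemma limit_points_club k A : is_cardinal k -> (omega <= k)%O ->
  subsets_of_card (below (csucc k)) (csucc k) A ->
  exists2 C, is_club (csucc k) C & forall d, C d ->
    [/\ (d < csucc k)%O, (k <= d)%O & is_cofinal d (A `&` below d)].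
Proof.
move=> kc wk [Ak Ac].
have /choice[h hP] a : exists b, (a < csucc k)%O -> A b /\ (a <= b)%O.
  have [ak|] := boolP (a < csucc k)%O; last by exists a.
  apply: contrapT => nb; have : (card A <= card (below a))%O.
    rewrite card_leE; [|exact: small_subset Ak (small_below _)|exact: small_below].
    apply: subset_card_le => b Ab; rewrite /below /= ltNge; apply/negP => ab.
    by apply: nb; exists b.
  by rewrite Ac leNgt (le_lt_trans (card_below_le a) ak).
exists (closure_points k h) => [|d [dk kd hd]].
  by apply: closure_points_club => // a /hP[/Ak].
split=> //; split=> [b []//|a ad].
have [Ah ah] := hP _ (lt_trans ad dk).
by exists (h a) => //; split => //; apply: hd.
Qed.

(** Above each point of a cofinal subset of d of size cf d, choose a point of A. *)
Lemma cofinal_thin d A : is_cofinal d A ->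
  exists e, [/\ e `<=` A, is_cofinal d e & (card e <= cf d)%O].
Proof.
move=> [Ad dA]; have [D [Dd dD] <-] := cf_witness d.
have /choice[f fP] a : exists b, (a < d)%O -> A b /\ (a <= b)%O.
  have [ad|] := boolP (a < d)%O; last by exists a.
  by have [b Ab ab] := dA _ ad; exists b.
have sD : small D := small_subset Dd (small_below d).
exists (f @` D); split=> [_ [a /Dd/fP[Af _] <-]//||].
  split=> [_ [a /Dd/fP[/Ad + _] <-]//|a ad].
  have [b Db ab] := dD _ ad; exists (f b); first by exists b.
  by apply: le_trans ab _; case: (fP _ (Dd _ Db)).
by rewrite card_leE ?card_image_le //; apply: small_image.
Qed.

(** * Coverings *)

(** The coverings in the definition of cov, over any set S: a covering has to be
    moved from lambda to larger ordinals, and from a cardinal to a set of that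
    size. *)
Definition covers (S : set Ord) (r2 r3 r4 : Ord) (X : set (set Ord)) : Prop :=
  X `<=` Psub r2 S /\
  forall b, Psub r3 S b -> exists2 Q, Psub r4 X Q & b `<=` \bigcup_(q in Q) q.

Lemma covers_congr (S S' : set Ord) r2 r3 r4 X : S #= S' -> covers S r2 r3 r4 X ->
  exists2 Y, covers S' r2 r3 r4 Y & Y #<= X.
Proof.
move=> /card_set_bijP[g [gS gi gs]] [XS cX].
have ginj x y : S x -> S y -> g x = g y -> x = y.
  by move=> Sx Sy; apply: gi; rewrite inE.
have cI x : x `<=` S -> card (g @` x) = card x.
  move=> xS; apply/card_congr/inj_card_eq => u v; rewrite !inE.
  by move=> /xS + /xS; apply: ginj.
pose G (q : set Ord) := g @` q; exists (G @` X); last exact: card_image_le.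
split=> [_ [x /XS[xS xc] <-]|b [bS bc]].
  by split; [move=> _ [u /xS Su <-]; apply: gS|rewrite cI].
have bE : b = g @` (S `&` g @^-1` b).
  apply/seteqP; split=> [u bu|_ [u [_ /= ?] <-]//].
  by have [v Sv vu] := gs _ (bS _ bu); exists v => //; split; rewrite //= vu.
have [|Q [QX Qc] bQ] := cX (S `&` g @^-1` b).
  by split; [move=> u []|rewrite -cI -?bE // => u []].
exists (G @` Q); last first.
  rewrite bE => _ [u ub <-]; have [q Qq qu] := bQ _ ub.
  by exists (g @` q); [exists q|exists u].
split; first by move=> _ [q /QX Xq <-]; exists q.
rewrite (_ : card _ = card Q) //; apply/card_congr/inj_card_eq => x y.
have half x' y' : X x' -> X y' -> G x' = G y' -> x' `<=` y'.
  move=> /XS[xS _] /XS[yS _] E u xu.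
  have [v yv vu] : G y' (g u) by rewrite -E; exists u.
  by rewrite -(ginj v u) //; [apply: yS|apply: xS].
rewrite !inE => /QX Xx /QX Xy E.
by apply/seteqP; split; apply: half.
Qed.

Lemma card_set1_lt_two (T : Type) (x : T) : (card [set x] < two)%O.
Proof.
rewrite ltNge card_leE; [|exact: small_set|exact/small_finite/finite_set1].
apply/negP => /(card_le_surjfun true)[g gb].
by have [_ -> t] := gb true I; have [_ -> f] := gb false I; rewrite t in f.
Qed.

Lemma card_le_set1 (T : Type) (x : T) k : (omega <= k)%O -> [set x] #<= below k.
Proof. by apply: card_le_finite_below; apply: finite_set1. Qed.

(** The family of all subsets of r1 of size < r2 is a covering. *)
Lemma cov_attained r1 r2 r3 r4 : (two <= r4)%O -> (r3 <= r2)%O ->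
  exists X, [/\ covers (below r1) r2 r3 r4 X, small X & card X = cov r1 r2 r3 r4].
Proof.
move=> r4_two r32.
have [|[X cX XE] _] := @ominP [set card X | X in is_covering r1 r2 r3 r4].
  exists (card (Psub r2 (below r1))), (Psub r2 (below r1)) => //; split=> // b [b1 b3].
  exists [set b]; last by move=> a ba; exists b.
  split; last exact: lt_le_trans (card_set1_lt_two b) r4_two.
  by move=> _ ->; split => //; apply: lt_le_trans r32.
exists X; split => //; apply: (small_subset (y := [set x | x `<=` below r1])).
  by case: cX => XP _ x /XP[].
exact: small_powerset.
Qed.

Lemma cov_le_covers r1 r2 r3 r4 k : (two <= r4)%O -> (r3 <= r2)%O ->
  is_cardinal k -> (cov r1 r2 r3 r4 <= k)%O ->
  exists2 X, covers (below r1) r2 r3 r4 X & X #<= below k.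
Proof.
move=> r4_two r32 kc; have [X [cX sX <-]] := cov_attained r1 r4_two r32.
by rewrite card_le_cardinal // => Xk; exists X.
Qed.

(** The image of e under h is covered by fewer than r4 <= cf d members of X. *)
Lemma covers_cofinal d r2 r3 r4 X e (h : Ord -> Ord) :
  covers (below d) r2 r3 r4 X -> (r4 <= cf d)%O ->
  is_cofinal d e -> (card e < r3)%O -> (forall a, e a -> (h a < d)%O) ->
  exists2 q, X q & is_cofinal d (e `&` h @^-1` q).
Proof.
move=> [XP cX] r4d de e3 hd; have se := small_cofinal de.
have [|Q [QX Q4] hQ] := cX (h @` e).
  split; first by move=> _ [a ea <-]; apply: hd.
  by apply: le_lt_trans e3; rewrite card_leE ?card_image_le //; apply: small_image.
have sQ : small Q.
  apply: (small_subset (y := [set x | x `<=` below d])); last exact: small_powerset.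
  by move=> q /QX/XP[].
have [||q Qq cq] := @cofinal_split _ d e Q (fun q => h @^-1` q) sQ de.
- by move=> a ea; have [|q Qq qa] := hQ (h a); [exists a|exists q].
- exact: lt_le_trans r4d.
by exists q => //; apply: QX.
Qed.

Lemma covers_level r k s d : (two <= s)%O -> is_cardinal k ->
  (cov k r r s <= k)%O -> (k <= d)%O -> (d < csucc k)%O ->
  exists2 X, covers (below d) r r s X & X #<= below k.
Proof.
move=> s2 kc ck kd dk; have [X cX Xk] := cov_le_covers s2 (lexx r) kc ck.
have kdE : below k #= below d.
  by rewrite card_eq_le subset_card_le ?below_lt_csucc //; apply: below_sub.
by have [Y cY /card_le_trans YX] := covers_congr kdE cX; exists Y => //; apply: YX.
Qed.

(** Used for the members of a covering whose size is already at most mu, to which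
    the bound on alpha does not apply. *)
Lemma covers_self (S : set Ord) r2 r3 s : (two <= s)%O -> (card S < r2)%O ->
  covers S r2 r3 s [set S].
Proof.
move=> s2 S2; split=> [_ ->|b [bS _]]; first by split.
exists [set S]; last by move=> a /bS Sa; exists S.
by split => //; apply: lt_le_trans s2; apply: card_set1_lt_two.
Qed.

(** The supremum defining alpha2 is over a family indexed by pairs of ordinals
    below chi, hence bounded. *)
Lemma alpha2_ubound chi s n t : is_cardinal t -> is_cardinal n ->
  (s <= n <= t)%O -> (t < chi)%O -> (cov t n n s <= alpha2 chi s)%O.
Proof.
move=> tc nc snt tchi; rewrite /alpha2.
set K := (X in osup X); suff /osupP[+ _] : has_ubound K by apply; exists t, n.
pose f (p : repr chi * repr chi) :=
  cov (otype (seg p.1)) (otype (seg p.2)) (otype (seg p.2)) s.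
have [b fb] := ord_bounded f.
exists b => _ [u [v [_ _ /andP[_ vu] uchi ->]]].
have vchi := le_lt_trans vu uchi.
rewrite -(otypeK chi) in uchi vchi.
by have [x ->] := lt_otype uchi; have [y ->] := lt_otype vchi; apply: fb (x, y).
Qed.

Lemma pow2_lt_ubound chi m : is_cardinal m -> (m < chi)%O -> (pow2 m <= pow2_lt chi)%O.
Proof.
move=> mc mchi; rewrite /pow2_lt.
set K := (X in osup X); suff /osupP[+ _] : has_ubound K by apply; exists m.
have [b fb] := ord_bounded (fun x : repr chi => pow2 (otype (seg x))).
exists b => _ [u [_ uchi] <-].
by rewrite -(otypeK chi) in uchi; have [x ->] := lt_otype uchi; apply: fb.
Qed.

Lemma alpha_attained chi : (omega < chi)%O ->
  exists s, [/\ is_cardinal s, (omega <= s)%O, (s < chi)%O & alpha2 chi s = alpha chi].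
Proof.
move=> wchi; have [|[s [sc /andP[ws sX]] sE] _] := @ominP [set alpha2 chi s |
    s in [set s | is_cardinal s /\ (omega <= s < chi)%O]]; last by exists s.
exists (alpha2 chi omega), omega => //; split; first exact: omega_cardinal.
by rewrite lexx.
Qed.

Lemma two_le_omega : (two <= omega)%O.
Proof. by apply/ltW; apply: card_finite. Qed.

(** * Guessing families *)

Lemma covers_card_le_mu (chi k s mu : Ord) (q : set Ord) :
  is_limit_cardinal chi -> is_cardinal k -> (omega <= k)%O ->
  is_cardinal s -> (omega <= s)%O -> is_cardinal mu -> (s <= mu)%O -> (mu < chi)%O ->
  (alpha2 chi s <= k)%O -> small q -> (card q < chi)%O ->
  exists2 Y, covers q (csucc mu) (csucc mu) s Y & Y #<= below k.
Proof.
move=> [_ lchi] kc wk sc ws muc smu muchi ak sq qchi.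
have s2 : (two <= s)%O := le_trans two_le_omega ws.
have [muSc muS _] := csuccP mu.
have [qmu|muq] := ltP (card q) (csucc mu).
  exists [set q]; last exact: card_le_set1.
  exact: covers_self.
have [|X cX Xk] := @cov_le_covers (card q) (csucc mu) (csucc mu) s k s2 (lexx _) kc.
  apply: le_trans ak; apply: alpha2_ubound => //; first exact: card_is_cardinal.
  by rewrite muq andbT (le_trans smu (ltW muS)).
have [Y cY /card_le_trans YX] := covers_congr (card_esym (cardP sq)) cX.
by exists Y => //; apply: YX.
Qed.

(** First a member q of a covering of d catches a cofinal part of e, then a member
    of a covering of q by sets of size at most mu catches a cofinal part of that. *)
Lemma thin_family (chi k s s' mu d : Ord) :
  is_limit_cardinal chi -> is_cardinal k -> (omega <= k)%O ->
  (two <= s')%O -> (s' <= mu)%O -> (cov k chi chi s' <= k)%O ->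
  is_cardinal s -> (omega <= s)%O -> is_cardinal mu -> (s <= mu)%O -> (mu < chi)%O ->
  (alpha2 chi s <= k)%O -> (k <= d)%O -> (d < csucc k)%O ->
  exists Y, [/\ Y `<=` Psub (csucc mu) (below d), Y #<= below k
    & forall e, cf d = mu -> is_cofinal d e -> (card e <= mu)%O ->
        exists2 y, Y y & is_cofinal d (e `&` y)].
Proof.
move=> lchi kc wk s'2 s'mu ck sc ws muc smu muchi ak kd dk.
have [X cX Xk] := covers_level s'2 kc ck kd dk.
have /choice[Z ZP] q : exists Y, X q ->
    covers q (csucc mu) (csucc mu) s Y /\ Y #<= below k.
  have [Xq|] := pselect (X q); last by exists set0.
  have [qd qchi] := cX.1 _ Xq; have sq := small_subset qd (small_below d).
  have [Y cY Yk] := covers_card_le_mu lchi kc wk sc ws muc smu muchi ak sq qchi.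
  by exists Y.
exists (\bigcup_(q in X) Z q); split.
- move=> y [q Xq Zy]; have [[/(_ _ Zy)[yq ymu] _] _] := ZP _ Xq.
  by split => //; apply: subset_trans yq _; case: (cX.1 _ Xq).
- by apply: card_le_bigcup => // q /ZP[].
move=> e dmu de emu; have se := small_cofinal de.
have [|||q Xq dq] := covers_cofinal (h := id) cX _ de.
- by rewrite dmu.
- exact: le_lt_trans muchi.
- by case: de.
have [[ZS cZ] _] := ZP _ Xq; have [_ muS _] := csuccP mu.
have [|Q [QZ Qs] eQ] := cZ (e `&` id @^-1` q).
  split; first by move=> a [].
  apply: le_lt_trans muS; apply: le_trans emu.
  by rewrite card_leE ?subset_card_le //; apply: small_subset se.
have sQ : small Q.
  apply: (small_subset (y := [set x | x `<=` below d])); last exact: small_powerset.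
  move=> y /QZ/ZS[yq _]; apply: subset_trans yq _; by case: (cX.1 _ Xq).
have [|y Qy [_ dy]] := cofinal_split sQ dq eQ; first by rewrite dmu (lt_le_trans Qs).
exists y; first by exists q => //; apply: QZ.
split=> [a [/(de.1)]//|a /dy[b [[eb _] yb] ab]]; by exists b.
Qed.

(** The subsets of the members of a covering, among which is the part of h(e)
    lying in the member q given by [covers_cofinal]. *)
Lemma subset_family (chi k s mu d : Ord) :
  is_cardinal k -> (omega <= k)%O -> (two <= s)%O -> (s <= mu)%O -> (mu < chi)%O ->
  (cov k chi chi s <= k)%O -> (pow2_lt chi <= k)%O -> (k <= d)%O -> (d < csucc k)%O ->
  exists2 Y : set (set Ord), Y #<= below k
    & forall e h, cf d = mu -> is_cofinal d e -> (card e <= mu)%O ->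
        (forall a, (a < d)%O -> (h a < d)%O) ->
        exists e', [/\ e' `<=` e, is_cofinal d e' & Y (h @` e')].
Proof.
move=> kc wk s2 smu muchi ck pk kd dk.
have [X cX Xk] := covers_level s2 kc ck kd dk.
exists (\bigcup_(q in X) [set z | z `<=` q]).
  apply: card_le_bigcup => // q /(cX.1)[qd qchi].
  have sq := small_subset qd (small_below d).
  have /card_eqPle[qc _] := cardP sq; apply: card_le_trans (card_le_powerset qc) _.
  rewrite -card_le_cardinal //; last exact: small_powerset.
  by apply: le_trans pk; apply: pow2_lt_ubound => //; apply: card_is_cardinal.
move=> e h dmu de emu hd.
have [|||q Xq dq] := covers_cofinal (h := h) cX _ de.
- by rewrite dmu.
- exact: le_lt_trans muchi.
- by move=> a /(de.1)/hd.
exists (e `&` h @^-1` q); split=> [a []//|//|].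
by exists q => // _ [a [_ qa] <-].
Qed.

(** Turns families of at most k sets, one for each d, into the doubly indexed
    families of the guessing principles. *)
Lemma enum_levels k (P : Ord -> set (set Ord)) (F : Ord -> set (set Ord) -> Prop) :
  (forall d, P d set0) ->
  (forall d, (k <= d)%O -> (d < csucc k)%O ->
     exists Y, [/\ Y `<=` P d, Y #<= below k & F d Y]) ->
  exists B : Ord -> Ord -> set Ord, (forall d i, P d (B d i)) /\
    forall d, (k <= d)%O -> (d < csucc k)%O -> exists2 Y, F d Y &
      forall y, Y y -> exists2 i, (i < d)%O & B d i = y.
Proof.
move=> P0 PF; suff /choice[B BP] d : exists B : Ord -> set Ord, (forall i, P d (B i)) /\
    ((k <= d)%O -> (d < csucc k)%O -> exists2 Y, F d Y &
      forall y, Y y -> exists2 i, (i < d)%O & B i = y).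
  by exists B; split=> [d|d]; case: (BP d).
have [/andP[kd dk]|nd] := boolP ((k <= d) && (d < csucc k))%O; last first.
  by exists (fun=> set0); split=> // kd dk; rewrite kd dk in nd.
have [Y [YP Yk FY]] := PF _ kd dk; have [B [BP BY]] := card_le_enum (P0 d) YP Yk.
exists B; split=> // _ _; exists Y => // y /BY[i ik <-].
by exists i => //; apply: lt_le_trans kd.
Qed.

Lemma subset_guessing (chi k s mu : Ord) :
  is_cardinal k -> (omega <= k)%O -> (two <= s)%O -> (s <= mu)%O -> (mu < chi)%O ->
  (cov k chi chi s <= k)%O -> (pow2_lt chi <= k)%O ->
  exists B : Ord -> Ord -> set Ord, forall d e h,
    (k <= d)%O -> (d < csucc k)%O -> cf d = mu -> is_cofinal d e ->
    (card e <= mu)%O -> (forall a, (a < d)%O -> (h a < d)%O) ->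
    exists i e', [/\ (i < d)%O, e' `<=` e, is_cofinal d e' & B d i = h @` e'].
Proof.
move=> kc wk s2 smu muchi ck pk.
have [//|d kd dk|B [_ BF]] := @enum_levels k (fun=> setT) (fun d Y =>
      forall e h, cf d = mu -> is_cofinal d e -> (card e <= mu)%O ->
        (forall a, (a < d)%O -> (h a < d)%O) ->
        exists e', [/\ e' `<=` e, is_cofinal d e' & Y (h @` e')]).
  have [Y] := subset_family kc wk s2 smu muchi ck pk kd dk.
  by exists Y.
exists B => d e h kd dk dmu de emu hd; have [Y FY BY] := BF _ kd dk.
have [e' [e'e de' Ye']] := FY e h dmu de emu hd.
by have [i id iE] := BY _ Ye'; exists i, e'.
Qed.

(** By 2^k = k^+, each b < k^+ has at most k^+ subsets. *)
Lemma bounded_sets_enum k : is_cardinal k -> (omega <= k)%O -> pow2 k = csucc k ->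
  exists a : Ord -> set Ord, forall b x, (b < csucc k)%O -> x `<=` below b ->
    exists2 i, (i < csucc k)%O & a i = x.
Proof.
move=> kc wk pk; have [kSc kS _] := csuccP k.
have : \bigcup_(b in below (csucc k)) [set x | x `<=` below b] #<= below (csucc k).
  apply: card_le_bigcup => // [|b bk]; first exact: le_trans wk (ltW kS).
  apply: card_le_trans (card_le_powerset (below_lt_csucc kc bk)) _.
  by rewrite -card_le_cardinal //; [rewrite -pk|exact: small_powerset].
move=> /(card_le_surjfun set0)[a aP]; exists a => b x bk xb.
by have [|i ik <-] := aP x; [exists b|exists i].
Qed.

Theorem mainTheorem10 (chi lambda : Ord)
  (chi_limit : is_limit_cardinal chi) (chi_uncountable : (omega < chi)%O)
  (lambda_card : is_cardinal lambda) (chi_le_lambda : (chi <= lambda)%O)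
  (chi_revision : revision_cardinal lambda chi) :
  [/\ (alpha chi <= lambda)%O ->
        exists s, [/\ is_cardinal s, (s < chi)%O
          & forall mu, is_regular mu -> (s <= mu)%O -> (mu < chi)%O ->
              club_cof_star (csucc mu) (csucc lambda)
                (restr_ideal (csucc lambda) (NS (csucc lambda))
                   (cof_points (csucc lambda) mu))],
      (pow2_lt chi <= lambda)%O ->
        exists s, [/\ is_cardinal s, (s < chi)%O
          & forall mu, is_regular mu -> (s <= mu)%O -> (mu < chi)%O ->
              club_star (csucc lambda)
                (restr_ideal (csucc lambda) (NS (csucc lambda))
                   (cof_points (csucc lambda) mu))]
    & (pow2_lt chi <= lambda)%O -> pow2 lambda = csucc lambda ->
        exists s, [/\ is_cardinal s, (s < chi)%O
          & forall mu, is_regular mu -> (s <= mu)%O -> (mu < chi)%O ->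
              diamond_star (csucc lambda)
                (restr_ideal (csucc lambda) (NS (csucc lambda))
                   (cof_points (csucc lambda) mu))]].
Proof.
have [s [sc s2 schi scov]] := chi_revision.
have wl : (omega <= lambda)%O := ltW (lt_le_trans chi_uncountable chi_le_lambda).
split=> [alambda|plambda|plambda pow2_lambda].
- have [s' [s'c ws' s'chi s'E]] := alpha_attained chi_uncountable.
  exists (Order.max s s'); split=> [||mu [muc wmu _]]; first by case: leP.
    by rewrite gt_max schi.
  rewrite ge_max => /andP[smu s'mu] muchi; rewrite -s'E in alambda.
  have [|d ld dl|B [BP BF]] := @enum_levels lambda
      (fun d => Psub (csucc mu) (below d)) (fun d Y =>
        forall e, cf d = mu -> is_cofinal d e -> (card e <= mu)%O ->
          exists2 y, Y y & is_cofinal d (e `&` y)).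
  - move=> d; split=> //; have [_ muS _] := csuccP mu.
    exact: lt_trans (card_finite (finite_set0 _)) (le_lt_trans wmu muS).
  - exact: (thin_family chi_limit lambda_card wl s2 smu scov s'c ws').
  exists B; split=> [d i _ _|A AP]; first exact: BP.
  have [C cC CA] := limit_points_club lambda_card wl AP.
  apply: (dual_filter_club cC) => [d []//|d /CA[dl ld dA] [_ dmu]].
  split=> //; have [Y FY BY] := BF _ ld dl.
  have dlim : is_limit d by apply: cf_is_limit; rewrite dmu.
  have [e [eA de]] := cofinal_thin dA; rewrite dmu => emu.
  have [y Yy [_ dy]] := FY _ dmu de emu; have [i id iy] := BY _ Yy.
  exists i => //; apply: osup_cofinal => //; rewrite iy.
  have [yd _] := BP d i; rewrite iy in yd.
  split=> [a [_ /yd]//|a /dy[b [eb yb] ab]].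
  by exists b => //; split => //; case: (eA _ eb).
- exists s; split=> // mu [muc wmu _] smu muchi.
  have [B BP] := subset_guessing lambda_card wl s2 smu muchi scov plambda.
  (* the sets that are not cofinal in d guess nothing there, and are replaced *)
  exists (fun d i => if `[< is_cofinal d (B d i) >] then B d i else below d).
  split=> [d i dlim _ _|A AP].
    have dd : is_cofinal d (below d) by split=> // a ad; exists a.
    by case: asboolP => [/[dup][[Bd _]] dB|_]; split=> //; apply: osup_cofinal.
  have [C cC CA] := limit_points_club lambda_card wl AP.
  apply: (dual_filter_club cC) => [d []//|d /CA[dl ld dA] [_ dmu]].
  have dlim : is_limit d by apply: cf_is_limit; rewrite dmu.
  have [e [eA de]] := cofinal_thin dA; rewrite dmu => emu.
  have [i [e' []]] := BP d e id ld dl dmu de emu (fun a ad => ad).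
  rewrite image_id => id e'e de' iE; split=> //; exists i => //; rewrite iE.
  case: asboolP => // _.
  by move=> a /e'e/eA[].
- exists s; split=> // mu [muc wmu _] smu muchi.
  have [B BP] := subset_guessing lambda_card wl s2 smu muchi scov plambda.
  have [a aP] := bounded_sets_enum lambda_card wl pow2_lambda.
  exists (fun d i => \bigcup_(x in B d i) a x `&` below d).
  split=> [d i _ _ b []//|A AP].
  have /choice[h hP] c : exists i, (c < csucc lambda)%O ->
      (i < csucc lambda)%O /\ a i = A `&` below c.
    have [cl|] := boolP (c < csucc lambda)%O; last by exists c.
    by have [|i il iE] := aP c (A `&` below c) cl; [move=> b []|exists i].
  have cC := closure_points_club lambda_card wl (fun c cl => (hP c cl).1).
  apply: (dual_filter_club cC) => [d []//|d [dl ld hd] [_ dmu]].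
  have dlim : is_limit d by apply: cf_is_limit; rewrite dmu.
  have [e de] := cf_witness d; rewrite dmu => emu.
  have [|i [e' [id _ de' iE]]] := BP d e h ld dl dmu de _ hd; first by rewrite emu.
  split=> //; exists i => //; rewrite iE bigcup_image.
  have ah c : e' c -> a (h c) = A `&` below c.
    by move=> /(de'.1) cd; case: (hP c (lt_trans cd dl)).
  apply/seteqP; split=> b [].
    by move=> [c e'c]; rewrite ah // => -[].
  move=> Ab bd; split => //.
  have [c e'c bc] := cofinal_below_limit dlim de' bd.
  by exists c => //; rewrite ah.
Qed.
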